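(* Let $q\in\mathbb{C}^*$ be not a root of unity, $j_1,j_2\in\frac12\mathbb{N}$, $a,b,u_1,u_2\in\mathbb{C}^*$ satisfy: (i) for any $\varepsilon_1,\varepsilon_2\in\{\pm1\}$, the $q$-strings $S(2j_1,(q/u_1^2)^{\varepsilon_1})$ and $S(2j_2,(q/u_2^2)^{\varepsilon_2})$ are in general position; (ii) for $i=1,2$, $ab,\ a/b\notin S(2j_i,q/u_i^2)\cup S(2j_i,(q/u_i^2)^{-1})$; (iii) $\pm a,\pm b\notin\{q^{m}\mid m\in\mathbb{Z},\ |m|\le 2j_1+2j_2-1\}$. Then the TD pairs $(\mathcal{A}_{12},\mathcal{B}_{21})$ and $(\mathcal{A}_{21},\mathcal{B}_{12})$ on $\mathbb{C}_{2j_1}[z_1]\otimes\mathbb{C}_{2j_2}[z_2]$ have diameter $d=\delta=2j_1+2j_2$ and, for $0\le p\le d$, $$\rho_p=\dim(V_p)=\dim(V_p^* )=\min(2j_1,p)+\min(2j_2,p)+1-p.$$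
   Context: $\mathbb{C}_{2j}[z]$ is the space of polynomials in $z$ of degree at most $2j$. Operators, with $\alpha=a+a^{-1}$, $\beta=b+b^{-1}$, $T^{(1)}_\pm f(z_1,z_2)=f(q^{\pm1}z_1,z_2)$, $T^{(2)}_\pm f(z_1,z_2)=f(z_1,q^{\pm1}z_2)$, $i=1,2$: $\mathcal{A}_i=u_iz_iq^{j_i}+u_i^{-1}z_i^{-1}q^{-j_i}-u_i^{-1}q^{-j_i}z_i^{-1}(1-z_iu_iq^{-j_i}a)(1-z_iu_iq^{-j_i}a^{-1})(T^{(i)}_+)^2$, $\mathcal{B}_i=u_i^{-1}z_iq^{-j_i}+u_iz_i^{-1}q^{j_i}-u_iq^{j_i}z_i^{-1}(1-z_iu_i^{-1}q^{j_i}b)(1-z_iu_i^{-1}q^{j_i}b^{-1})(T^{(i)}_-)^2$, $\mathcal{A}_{12}=\mathcal{A}_1+q^{-2j_1}(T^{(1)}_+)^2(\mathcal{A}_2-\alpha)$, $\mathcal{B}_{12}=\mathcal{B}_2+(\mathcal{B}_1-\beta)q^{2j_2}(T^{(2)}_-)^2$, $\mathcal{A}_{21}=\mathcal{A}_2+(\mathcal{A}_1-\alpha)q^{-2j_2}(T^{(2)}_+)^2$, $\mathcal{B}_{21}=\mathcal{B}_1+q^{2j_1}(T^{(1)}_-)^2(\mathcal{B}_2-\beta)$. Tridiagonal (TD) pair: for a finite-dimensional nonzero $\mathbb{C}$-vector space $V$, an ordered pair of linear maps $\mathsf{A},\mathsf{A}^*:V\to V$ such that (1) both are diagonalizable; (2)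 there is an ordering $V_0,\dots,V_d$ of the eigenspaces of $\mathsf{A}$ with $\mathsf{A}^*V_p\subseteq V_{p-1}+V_p+V_{p+1}$ for $0\le p\le d$ ($V_{-1}=V_{d+1}=0$); (3) there is an ordering $V_0^*,\dots,V_\delta^*$ of the eigenspaces of $\mathsf{A}^*$ with $\mathsf{A}V_p^*\subseteq V_{p-1}^*+V_p^*+V_{p+1}^*$ for $0\le p\le\delta$ ($V^*_{-1}=V^*_{\delta+1}=0$); (4) no subspace $W$ other than $0,V$ satisfies $\mathsf{A}W\subseteq W$ and $\mathsf{A}^*W\subseteq W$. It is known that $d=\delta$ (the diameter) and $\dim V_p=\dim V_p^*=:\rho_p$; $(\rho_0,\dots,\rho_d)$ is the shape. Here $V_p$ (resp. $V_p^*$) is the eigenspace of $\mathsf A$ (resp. $\mathsf A^*$) with eigenvalue $q^{2p-2j_1-2j_2}a+q^{2j_1+2j_2-2p}a^{-1}$ (resp. $q^{2p-2j_1-2j_2}b+q^{2j_1+2j_2-2p}b^{-1}$). Under (i)–(iii) the two pairs in the claim are TD pairs. $q$-strings: for $v\in\mathbb{C}^*$, $d\in\mathbb{N}$, $S(d,v)=\{vq^{2i-d+1}\mid 0\le i\le d-1\}$. Two $q$-strings $S(d,v),S(d',v')$ are in general position if either $S(d,v)\cup S(d',v')$ is not a $q$-string, or $S(d,v)\subseteq S(d',v')$, or $S(d,v)\supseteq S(d',v')$. *)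

(* Defs.v *)
From HB Require Import structures.
From mathcomp Require Import all_boot all_order all_algebra.
From mathcomp Require Import boolp classical_sets reals complex.
From mathcomp Require Import ring.

Set Implicit Arguments.
Unset Strict Implicit.
Unset Printing Implicit Defensive.
Import Order.TTheory GRing.Theory Num.Theory.
Local Open Scope ring_scope.

Export vector.passmx (leigenspace, leigenvalue).

Section TridiagonalPairs.
Variables (K : fieldType) (V : vectType K).
Implicit Types A As : 'End(V).

Definition diagonalizable_end A : Prop :=
  exists X : seq V, basis_of fullv X /\
    forall x, x \in X -> exists t : K, A x = t *: x.

(* [E 0, ..., E d] lists every eigenspace of [A] exactly once. *)
Definition eigenspace_ordering A (d : nat) (E : 'I_d.+1 -> {vspace V}) : Prop :=
  [/\ injective E,
      forall p, exists2 t : K, leigenvalue A t & E p = leigenspace A t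
    & forall t : K, leigenvalue A t -> exists p, E p = leigenspace A t].

(* The sum ranges over the indices r with |r - p| <= 1, so the conventions
   V_(-1) = V_(d+1) = 0 are built in. *)
Definition tridiagonal_on As (d : nat) (E : 'I_d.+1 -> {vspace V}) : Prop :=
  forall p : 'I_d.+1,
    (As @: E p <= \sum_(r < d.+1 | (r <= p.+1)%N && (p <= r.+1)%N) E r)%VS.

Definition irreducible_pair A As : Prop :=
  forall W : {vspace V}, (A @: W <= W)%VS -> (As @: W <= W)%VS ->
    W = 0%VS \/ W = fullv.

(* [(A, As)] is a TD pair with d + 1 eigenspaces of [A] and delta + 1
   eigenspaces of [As]. *)
Definition TD_pair A As (d delta : nat) : Prop :=
  [/\ (0 < \dim {:V})%N,
      diagonalizable_end A /\ diagonalizable_end As,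
      exists E : 'I_d.+1 -> {vspace V},
        eigenspace_ordering A E /\ tridiagonal_on As E,
      exists Es : 'I_delta.+1 -> {vspace V},
        eigenspace_ordering As Es /\ tridiagonal_on A Es
    & irreducible_pair A As].

(* The TD pair [(A, As)] has diameter [N] (on both sides), its eigenspaces are
   V_p = ker (A - th p), V*_p = ker (As - ths p) for 0 <= p <= N, and its shape
   is [rho].  The diameter is asserted twice: N + 1 is the number of eigenspaces
   of [A] and of [As], and it is the length of every pair of orderings that
   witnesses the tridiagonality. *)
Definition TD_diameter_shape A As (N : nat) (th ths : nat -> K)
    (rho : nat -> nat) : Prop :=
  [/\ forall d delta, TD_pair A As d delta -> d = N /\ delta = N,
      eigenspace_ordering A (fun p : 'I_N.+1 => leigenspace A (th p)),
      eigenspace_ordering As (fun p : 'I_N.+1 => leigenspace As (ths p))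
    & forall p, (p <= N)%N ->
        \dim (leigenspace A (th p)) = rho p /\
        \dim (leigenspace As (ths p)) = rho p].

End TridiagonalPairs.

Section QStrings.
Variables (K : fieldType) (q : K).

Definition qstring (d : nat) (v : K) : seq K :=
  [seq v * q ^ (2 * i%:Z - d%:Z + 1) | i <- iota 0 d].

Definition is_qstring (X : seq K) : Prop :=
  exists (d : nat) (v : K), v != 0 /\ X =i qstring d v.

Definition general_position (X Y : seq K) : Prop :=
  [\/ ~ is_qstring (X ++ Y), {subset X <= Y} | {subset Y <= X}].

(* The p-th eigenvalue, with N = 2 j_1 + 2 j_2. *)
Definition theta (N : nat) (c : K) (p : nat) : K :=
  q ^ (2 * p%:Z - N%:Z) * c + q ^ (N%:Z - 2 * p%:Z) * c^-1.

End QStrings.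

(* C_n1[z1] (x) C_n2[z2], with n_i = 2 j_i.  An element is given by its coordinates in the basis z1^i (x) z2^k,
   i <= n1, k <= n2; [bieval] is the polynomial function it stands for. *)
Notation bipoly K n1 n2 := 'M[K]_(n1.+1, n2.+1).

Definition bieval (K : fieldType) (n1 n2 : nat) (f : bipoly K n1 n2) : K -> K -> K :=
  fun z1 z2 => \sum_(i < n1.+1) \sum_(k < n2.+1) f i k * z1 ^+ i * z2 ^+ k.

Section Operators.
Variable K : fieldType.
Local Notation fct := (K -> K -> K).

(* The formulas involve z1^-1 and z2^-1: the operators act on functions on
   (C^* )^2, and their values where z1 = 0 or z2 = 0 are irrelevant. *)

Definition shift1 (c : K) (f : fct) : fct := fun z1 z2 => f (c * z1) z2.
Definition shift2 (c : K) (f : fct) : fct := fun z1 z2 => f z1 (c * z2).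
Definition coord1 : fct := fun z1 _ => z1.
Definition coord2 : fct := fun _ z2 => z2.

(* Here and below [s] is a square root of [q] and [n = 2 j], so that
   q^j = s ^+ n and q^(-j) = s ^- n, also for half-integer j. *)
Definition opA_gen (T : fct -> fct) (z : fct) (s : K) (n : nat) (a u : K)
    (f : fct) : fct := fun z1 z2 =>
  (u * z z1 z2 * s ^+ n + u^-1 * (z z1 z2)^-1 * s ^- n) * f z1 z2
  - u^-1 * s ^- n * (z z1 z2)^-1
    * (1 - z z1 z2 * u * s ^- n * a) * (1 - z z1 z2 * u * s ^- n * a^-1)
    * T (T f) z1 z2.

Definition opB_gen (T : fct -> fct) (z : fct) (s : K) (n : nat) (b u : K)
    (f : fct) : fct := fun z1 z2 =>
  (u^-1 * z z1 z2 * s ^- n + u * (z z1 z2)^-1 * s ^+ n) * f z1 z2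
  - u * s ^+ n * (z z1 z2)^-1
    * (1 - z z1 z2 * u^-1 * s ^+ n * b) * (1 - z z1 z2 * u^-1 * s ^+ n * b^-1)
    * T (T f) z1 z2.

Variables (q s : K) (n1 n2 : nat) (a b u1 u2 : K).

Definition T1p := shift1 q.
Definition T1m := shift1 q^-1.
Definition T2p := shift2 q.
Definition T2m := shift2 q^-1.

Definition opA1 := opA_gen T1p coord1 s n1 a u1.
Definition opA2 := opA_gen T2p coord2 s n2 a u2.
Definition opB1 := opB_gen T1m coord1 s n1 b u1.
Definition opB2 := opB_gen T2m coord2 s n2 b u2.

Definition opA12 (f : fct) : fct := fun z1 z2 =>
  opA1 f z1 z2
  + q ^- n1 * T1p (T1p (fun x y => opA2 f x y - (a + a^-1) * f x y)) z1 z2.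

Definition opB12 (f : fct) : fct :=
  let g : fct := fun x y => q ^+ n2 * T2m (T2m f) x y in
  fun z1 z2 => opB2 f z1 z2 + (opB1 g z1 z2 - (b + b^-1) * g z1 z2).

Definition opA21 (f : fct) : fct :=
  let g : fct := fun x y => q ^- n2 * T2p (T2p f) x y in
  fun z1 z2 => opA2 f z1 z2 + (opA1 g z1 z2 - (a + a^-1) * g z1 z2).

Definition opB21 (f : fct) : fct := fun z1 z2 =>
  opB1 f z1 z2
  + q ^+ n1 * T1m (T1m (fun x y => opB2 f x y - (b + b^-1) * f x y)) z1 z2.

(* The endomorphism [F] of the polynomial space is the action of [D]. *)
Definition induces (D : fct -> fct) (F : 'End(bipoly K n1 n2)) : Prop :=
  forall (f : bipoly K n1 n2) (z1 z2 : K), z1 != 0 -> z2 != 0 ->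
    bieval (F f) z1 z2 = D (bieval f) z1 z2.

(* The endomorphism induced by [D]; lemmas [induces_unique], [A12P], [B12P],
   [A21P] and [B21P] below show that it is unique, and that it exists for the
   four operators of interest. *)
Definition induced (D : fct -> fct) : 'End(bipoly K n1 n2) :=
  xget 0 [set F | induces D F]%classic.

Definition A12 := induced opA12.
Definition B12 := induced opB12.
Definition A21 := induced opA21.
Definition B21 := induced opB21.

End Operators.

Arguments coord1 {K}.
Arguments coord2 {K}.

Lemma induces_unique (K : numFieldType) (n1 n2 : nat)
    (D : (K -> K -> K) -> K -> K -> K) (F G : 'End(bipoly K n1 n2)) :
  induces D F -> induces D G -> F = G.
Proof.
have poly0 n (c : 'I_n -> K) :
    (forall x, x != 0 -> \sum_(i < n) c i * x ^+ i = 0) -> forall i, c i = 0.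
  move=> c0; pose p := \poly_(j < n) (if insub j is Some i then c i else 0).
  have pE x : p.[x] = \sum_(i < n) c i * x ^+ i.
    rewrite (horner_coef_wide _ (size_poly _ _)); apply: eq_bigr => i _.
    by rewrite coef_poly ltn_ord valK.
  have p0 : p = 0.
    apply: (@roots_geq_poly_eq0 _ p [seq j.+1%:R | j <- iota 0 n]).
    - by apply/allP => _ /mapP[j _ ->]; rewrite rootE pE c0 // pnatr_eq0.
    - rewrite map_inj_uniq ?iota_uniq // => j k /eqP.
      by rewrite eqr_nat => /eqP[].
    - by rewrite size_map size_iota size_poly.
  move=> i; have := congr1 (fun r : {poly K} => r`_i) p0.
  by rewrite coef_poly coef0 ltn_ord valK.
move=> DF DG; apply/lfunP => f; apply/matrixP => i k.
apply/eqP; rewrite -subr_eq0; apply/eqP.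
pose h := F f - G f.
have h0 x y : x != 0 -> y != 0 -> bieval h x y = 0.
  move=> x0 y0; have := DF f x y x0 y0; rewrite -(DG f x y x0 y0) /bieval.
  move=> /eqP; rewrite -subr_eq0 -sumrB => /eqP E; rewrite -{}[RHS]E.
  apply: eq_bigr => i' _; rewrite -sumrB; apply: eq_bigr => k' _.
  by rewrite !mxE !mulrBl.
have -> : F f i k - G f i k = h i k by rewrite !mxE.
apply: (poly0 _ (fun k => h i k)) => y y0.
apply: (poly0 _ (fun i => \sum_(k < n2.+1) h i k * y ^+ k)) => x x0.
rewrite -[RHS](h0 x y x0 y0); apply: eq_bigr => i' _.
by rewrite mulr_suml; apply: eq_bigr => k' _; rewrite mulrAC.
Qed.

Section Existence.
Variables (K : fieldType) (n1 n2 : nat).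
Local Notation fct := (K -> K -> K).
Local Notation V := (bipoly K n1 n2).

Let induces1 (D : fct -> fct) (P : nat -> {poly K}) :
    (forall i, (i <= n1)%N -> (size (P i) <= n1.+1)%N) ->
    (forall (f : V) x y, x != 0 -> D (bieval f) x y =
      \sum_(i < n1.+1) \sum_(k < n2.+1) f i k * (P i).[x] * y ^+ k) ->
  exists F : 'End(V), induces D F.
Proof.
move=> sP DE; pose L := \matrix_(i < n1.+1, i' < n1.+1) (P i')`_i.
exists (linfun (mulmx L)) => f x y x0 y0; rewrite DE // lfunE /= /bieval.
transitivity (\sum_(i < n1.+1) \sum_(k < n2.+1) \sum_(i' < n1.+1)
    f i' k * (P i')`_i * x ^+ i * y ^+ k).
  apply: eq_bigr => i _; apply: eq_bigr => k _; rewrite mxE !mulr_suml.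
  by apply: eq_bigr => i' _; rewrite mxE (mulrC (P i')`_i).
under [LHS]eq_bigr => i _ do rewrite exchange_big.
rewrite exchange_big; apply: eq_bigr => i' _.
rewrite exchange_big; apply: eq_bigr => k _.
rewrite (horner_coef_wide _ (sP i' (ltn_ord i'))) mulr_sumr mulr_suml.
by apply: eq_bigr => i _; rewrite !mulrA.
Qed.

Let induces2 (D : fct -> fct) (P : nat -> {poly K}) :
    (forall k, (k <= n2)%N -> (size (P k) <= n2.+1)%N) ->
    (forall (f : V) x y, y != 0 -> D (bieval f) x y =
      \sum_(i < n1.+1) \sum_(k < n2.+1) f i k * x ^+ i * (P k).[y]) ->
  exists F : 'End(V), induces D F.
Proof.
move=> sP DE; pose L := \matrix_(k' < n2.+1, k < n2.+1) (P k')`_k.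
exists (linfun (mulmxr L)) => f x y x0 y0; rewrite DE // lfunE /= /bieval.
apply: eq_bigr => i _.
transitivity (\sum_(k < n2.+1) \sum_(k' < n2.+1)
    f i k' * (P k')`_k * x ^+ i * y ^+ k).
  apply: eq_bigr => k _; rewrite mxE !mulr_suml.
  by apply: eq_bigr => k' _; rewrite mxE.
rewrite exchange_big; apply: eq_bigr => k' _.
rewrite (horner_coef_wide _ (sP k' (ltn_ord k'))) mulr_sumr.
by apply: eq_bigr => k _; rewrite !mulrA; congr (_ * _); rewrite mulrAC.
Qed.

Let polA (s : K) n a u i : {poly K} :=
  (u^-1 * s ^- n * (1 - s ^+ (4 * i))) *: 'X^(i.-1)
  + ((a + a^-1) * s ^- n * s ^- n * s ^+ (4 * i)) *: 'X^i
  + (u * s ^+ n - u * s ^- n * s ^- n * s ^- n * s ^+ (4 * i)) *: 'X^(i.+1).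

Let size_polA (s : K) n a u i : s != 0 -> (i <= n)%N ->
  (size (polA s n a u i) <= n.+1)%N.
Proof.
move=> s0 lein; rewrite /polA.
apply: (leq_trans (size_polyD _ _)); rewrite geq_max; apply/andP; split.
  apply: (leq_trans (size_polyD _ _)); rewrite geq_max; apply/andP; split;
    apply: (leq_trans (size_scale_leq _ _)); rewrite size_polyXn ltnS //.
  exact: leq_trans (leq_pred _) lein.
move: lein; rewrite leq_eqVlt => /orP[/eqP ->|ltin].
  rewrite [X in X *: _](_ : _ = 0) ?scale0r ?size_poly0 //.
  rewrite mulnC exprM; field; by rewrite expf_neq0.
by apply: (leq_trans (size_scale_leq _ _)); rewrite size_polyXn ltnS.
Qed.

Let polAE (s : K) n a u i x : s != 0 -> a != 0 -> u != 0 -> x != 0 ->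
  (polA s n a u i).[x] =
  (u * x * s ^+ n + u^-1 * x^-1 * s ^- n) * x ^+ i
  - u^-1 * s ^- n * x^-1 * (1 - x * u * s ^- n * a)
    * (1 - x * u * s ^- n * a^-1) * (s ^+ 2 * (s ^+ 2 * x)) ^+ i.
Proof.
move=> s0 a0 u0 x0.
have -> : (s ^+ 2 * (s ^+ 2 * x)) ^+ i = s ^+ (4 * i) * x ^+ i.
  by rewrite mulrA -exprD exprMn -exprM.
rewrite /polA !hornerE.
have sn0 : s ^+ n != 0 by rewrite expf_neq0.
case: i => [|i] /=; first by rewrite muln0 !expr0; field; rewrite sn0 x0 a0 u0.
by rewrite ![x ^+ _.+1]exprS; field; rewrite sn0 x0 a0 u0.
Qed.

Let opBA T z (s : K) n b u f x y :
  opB_gen T z s n b u f x y = opA_gen T z s^-1 n b u^-1 f x y.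
Proof. by rewrite /opB_gen /opA_gen exprVn !invrK. Qed.

Let ex_A1 (q s a u : K) : s ^+ 2 = q -> s != 0 -> a != 0 -> u != 0 ->
  exists F : 'End(V), induces (opA_gen (shift1 q) coord1 s n1 a u) F.
Proof.
move=> <- s0 a0 u0; apply: (@induces1 _ (polA s n1 a u)).
  by move=> i; apply: size_polA.
move=> f x y x0; rewrite /opA_gen /shift1 /coord1 /bieval !mulr_sumr -sumrB.
apply: eq_bigr => i _; rewrite !mulr_sumr -sumrB; apply: eq_bigr => k _.
rewrite polAE //; ring.
Qed.

Let ex_A2 (q s a u : K) : s ^+ 2 = q -> s != 0 -> a != 0 -> u != 0 ->
  exists F : 'End(V), induces (opA_gen (shift2 q) coord2 s n2 a u) F.
Proof.
move=> <- s0 a0 u0; apply: (@induces2 _ (polA s n2 a u)).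
  by move=> i; apply: size_polA.
move=> f x y x0; rewrite /opA_gen /shift2 /coord2 /bieval !mulr_sumr -sumrB.
apply: eq_bigr => i _; rewrite !mulr_sumr -sumrB; apply: eq_bigr => k _.
rewrite polAE //; ring.
Qed.

Let ex_B1 (q s a u : K) : s ^+ 2 = q -> s != 0 -> a != 0 -> u != 0 ->
  exists F : 'End(V), induces (opB_gen (shift1 q^-1) coord1 s n1 a u) F.
Proof.
move=> sq s0 a0 u0.
have [||||F HF] := @ex_A1 q^-1 s^-1 a u^-1; rewrite ?invr_eq0 //.
  by rewrite exprVn sq.
by exists F => f x y x0 y0; rewrite opBA HF.
Qed.

Let ex_B2 (q s a u : K) : s ^+ 2 = q -> s != 0 -> a != 0 -> u != 0 ->
  exists F : 'End(V), induces (opB_gen (shift2 q^-1) coord2 s n2 a u) F.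
Proof.
move=> sq s0 a0 u0.
have [||||F HF] := @ex_A2 q^-1 s^-1 a u^-1; rewrite ?invr_eq0 //.
  by rewrite exprVn sq.
by exists F => f x y x0 y0; rewrite opBA HF.
Qed.

Let ex_T1 (q c : K) :
  exists F : 'End(V), induces (fun f x y => c * shift1 q (shift1 q f) x y) F.
Proof.
apply: (@induces1 _ (fun i => (c * (q ^+ 2) ^+ i) *: 'X^i)).
  by move=> i lei; apply: (leq_trans (size_scale_leq _ _)); rewrite size_polyXn.
move=> f x y _; rewrite /shift1 /bieval mulr_sumr; apply: eq_bigr => i _.
rewrite mulr_sumr; apply: eq_bigr => k _; rewrite hornerZ hornerXn !exprMn.
ring.
Qed.

Let ex_T2 (q c : K) :
  exists F : 'End(V), induces (fun f x y => c * shift2 q (shift2 q f) x y) F.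
Proof.
apply: (@induces2 _ (fun i => (c * (q ^+ 2) ^+ i) *: 'X^i)).
  by move=> i lei; apply: (leq_trans (size_scale_leq _ _)); rewrite size_polyXn.
move=> f x y _; rewrite /shift2 /bieval mulr_sumr; apply: eq_bigr => i _.
rewrite mulr_sumr; apply: eq_bigr => k _; rewrite hornerZ hornerXn !exprMn.
ring.
Qed.

Let bievalD (f g : V) x y : bieval (f + g) x y = bieval f x y + bieval g x y.
Proof.
rewrite /bieval -big_split; apply: eq_bigr => i _; rewrite -big_split.
by apply: eq_bigr => k _; rewrite mxE !mulrDl.
Qed.

Let bievalZ c (f : V) x y : bieval (c *: f) x y = c * bieval f x y.
Proof.
rewrite /bieval mulr_sumr; apply: eq_bigr => i _; rewrite mulr_sumr.
by apply: eq_bigr => k _; rewrite mxE !mulrA.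
Qed.

Let ex_ST (D1 D2 T : fct -> fct) (c : K) :
    (forall f g, (forall x y, x != 0 -> y != 0 -> f x y = g x y) ->
       forall x y, x != 0 -> y != 0 -> T f x y = T g x y) ->
    (exists F : 'End(V), induces D1 F) -> (exists F : 'End(V), induces D2 F) ->
    (exists F : 'End(V), induces T F) ->
  exists F : 'End(V), induces (fun f x y =>
    D1 f x y + T (fun x y => D2 f x y - c * f x y) x y) F.
Proof.
move=> Tloc [F1 H1] [F2 H2] [G HG].
exists (F1 + (G \o (F2 - c *: \1%VF))%VF)%R => f x y x0 y0.
rewrite add_lfunE bievalD H1 // comp_lfunE HG //; congr (_ + _).
apply: Tloc => // x' y' x'0 y'0.
rewrite add_lfunE opp_lfunE scale_lfunE id_lfunE -scaleNr.
by rewrite bievalD bievalZ H2 // mulNr.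
Qed.

Let ex_TS (D1 D2 T : fct -> fct) (c : K) :
    (forall f g, (forall x y, x != 0 -> y != 0 -> f x y = g x y) ->
       forall x y, x != 0 -> y != 0 -> D2 f x y = D2 g x y) ->
    (exists F : 'End(V), induces D1 F) -> (exists F : 'End(V), induces D2 F) ->
    (exists F : 'End(V), induces T F) ->
  exists F : 'End(V), induces (fun f x y =>
    D1 f x y + (D2 (T f) x y - c * T f x y)) F.
Proof.
move=> Dloc [F1 H1] [F2 H2] [G HG].
exists (F1 + ((F2 - c *: \1%VF) \o G)%VF)%R => f x y x0 y0.
rewrite add_lfunE bievalD H1 // comp_lfunE; congr (_ + _).
rewrite add_lfunE opp_lfunE scale_lfunE id_lfunE -scaleNr.
rewrite bievalD bievalZ H2 // HG // mulNr.
by congr (_ - _); apply: Dloc => // x' y' x'0 y'0; rewrite HG.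
Qed.

Variables (q s a b u1 u2 : K).
Hypotheses (hs : s ^+ 2 = q) (q0 : q != 0).
Hypotheses (a0 : a != 0) (b0 : b != 0) (u10 : u1 != 0) (u20 : u2 != 0).

Let s0 : s != 0. Proof. by move: q0; rewrite -hs expf_eq0. Qed.

Lemma A12P : induces (opA12 q s n1 n2 a u1 u2) (A12 q s n1 n2 a u1 u2).
Proof.
apply: xgetPex; apply: ex_ST (ex_A1 hs s0 a0 u10) (ex_A2 hs s0 a0 u20)
  (ex_T1 q (q ^- n1)).
by move=> f g fg x y x0 y0; rewrite /shift1 fg // !mulf_neq0.
Qed.

Lemma B21P : induces (opB21 q s n1 n2 b u1 u2) (B21 q s n1 n2 b u1 u2).
Proof.
apply: xgetPex; apply: ex_ST (ex_B1 hs s0 b0 u10) (ex_B2 hs s0 b0 u20)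
  (ex_T1 q^-1 (q ^+ n1)).
by move=> f g fg x y x0 y0; rewrite /shift1 fg // !mulf_neq0 ?invr_eq0.
Qed.

Lemma A21P : induces (opA21 q s n1 n2 a u1 u2) (A21 q s n1 n2 a u1 u2).
Proof.
apply: xgetPex; apply: ex_TS (ex_A2 hs s0 a0 u20) (ex_A1 hs s0 a0 u10)
  (ex_T2 q (q ^- n2)).
move=> f g fg x y x0 y0.
by rewrite /opA_gen /shift1 !fg // !mulf_neq0.
Qed.

Lemma B12P : induces (opB12 q s n1 n2 b u1 u2) (B12 q s n1 n2 b u1 u2).
Proof.
apply: xgetPex; apply: ex_TS (ex_B2 hs s0 b0 u20) (ex_B1 hs s0 b0 u10)
  (ex_T2 q^-1 (q ^+ n2)).
move=> f g fg x y x0 y0.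
by rewrite /opB_gen /shift1 !fg // !mulf_neq0 ?invr_eq0.
Qed.

End Existence.

(* Main.v *)
(* T^(1) commutes with A_2, so A_12 can be restricted to C[z1] (x) psi, where
   psi is an eigenvector of A_2 in C[z2] with eigenvalue a' + 1/a',
   a' = q^(2k - 2 j_2) a.  There A_12 acts as A_1 with a replaced by a'.  In one
   variable, A_i is bidiagonal in the basis of q-shifted factorials
   prod_(l < r) (1 - u q^(-j) a q^(2l) z), with diagonal entries
   q^(2r - 2j) a + q^(2j - 2r) / a, which are distinct by (iii).  Hence A_12 has an
   eigenbasis indexed by pairs (i, k) with eigenvalues theta (i + k), and the
   multiplicities count antidiagonals.  A_21 is treated symmetrically, and the
   operators B are the operators A for the inverses of q, b, u_1, u_2. *)
From HB Require Import structures.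
Require Import Defs.
From mathcomp Require Import all_boot all_order all_algebra.
From mathcomp Require Import reals complex.
From mathcomp Require Import ring zify.

Import Order.TTheory GRing.Theory Num.Theory.
Local Open Scope ring_scope.

(** * Eigenspaces: dimensions from an eigenbasis, and orderings *)

Lemma memv_leigenspace (K : fieldType) (V : vectType K) (F : 'End(V)) (t : K)
    (v : V) :
  (v \in leigenspace F t) = (F v == t *: v).
Proof.
rewrite memv_ker add_lfunE opp_lfunE scale_lfunE id_lfunE.
by rewrite subr_eq0.
Qed.

(** Expanding an eigenvector for [t] in the eigenbasis, only the [e i] with [lam i = t] can occur.
    These span the eigenspace and are free, so the dimension is their number. *)
Lemma dim_leigenspace_eigenbasis (K : fieldType) (V : vectType K) (F : 'End(V))
    (I : finType) (e : I -> V) (lam : I -> K) :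
  (forall c : I -> K, \sum_i c i *: e i = 0 -> forall i, c i = 0) ->
  #|I| = \dim {:V} -> (forall i, F (e i) = lam i *: e i) ->
  forall t, \dim (leigenspace F t) = #|[pred i | lam i == t]|.
Proof.
move=> free_e cardI Fe t.
have e_neq0 i : e i != 0.
  apply/eqP => ei0.
  have s0 : \sum_k (k == i)%:R *: e k = 0.
    rewrite (bigD1 i) //= ei0 scaler0 add0r big1 // => k /negPf ->.
    by rewrite scale0r.
  by have /eqP := free_e (fun k => (k == i)%:R) s0 i; rewrite eqxx oner_eq0.
pose X := codom_tuple e.
have X_nth i : X`_(enum_rank i) = e i by rewrite nth_image enum_rankK.
have sumX (c : 'I_#|I| -> K) : \sum_k c k *: X`_k = \sum_i c (enum_rank i) *: e i.
  rewrite (reindex enum_rank) /=; last exact: onW_bij (@enum_rank_bij I).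
  by apply: eq_bigr => i _; rewrite X_nth.
have freeX : free X.
  apply/freeP => c; rewrite sumX => /free_e c0 k.
  by rewrite -(enum_valK k) c0.
have basisX : basis_of fullv X.
  by rewrite basisEfree freeX subvf size_tuple -cardI leqnn.
pose Y := [seq v <- X | F v == t *: v].
have FeE i : (F (e i) == t *: e i) = (lam i == t).
  by rewrite Fe -subr_eq0 -scalerBl scaler_eq0 subr_eq0 (negPf (e_neq0 i)) orbF.
have -> : leigenspace F t = <<Y>>%VS.
  apply/eqP; rewrite eqEsubv; apply/andP; split; last first.
    apply/span_subvP => v; rewrite mem_filter memv_leigenspace.
    by case/andP.
  apply/subvP => v; rewrite memv_leigenspace.
  rewrite (coord_basis basisX (memvf v)) sumX.
  set c := (fun i => coord X (enum_rank i) v).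
  rewrite -subr_eq0 linear_sum scaler_sumr -sumrB => /eqP Fv.
  (* [F v - t v] is the combination of the [e i] with exactly these coefficients. *)
  have c0 : forall i, c i * (lam i - t) = 0.
    apply: free_e; rewrite -[RHS]Fv; apply: eq_bigr => i _.
    by rewrite linearZ /= Fe !scalerA -scalerBl mulrBr (mulrC t).
  apply: rpred_sum => i _; have /eqP := c0 i.
  rewrite mulf_eq0 => /orP[/eqP ci0|].
    by rewrite [X in X *: _]ci0 scale0r mem0v.
  rewrite subr_eq0 -FeE => Fei; apply: memvZ; apply: memv_span.
  by rewrite mem_filter Fei codom_f.
have -> : \dim <<Y>> = size Y by apply/eqP; apply: filter_free.
rewrite /Y size_filter /= /codom /image_mem count_map -size_filter cardE.
rewrite /enum_mem -filter_predI; congr size; apply: eq_filter => i /=.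
by rewrite FeE andbT.
Qed.

(** Every [E p] occurs in [E'], which yields an injection of index sets. Applied in both directions,
    it shows that all orderings have the same length. *)
Lemma eigenspace_ordering_leq (K : fieldType) (V : vectType K) (F : 'End(V))
    (d d' : nat) (E : 'I_d.+1 -> {vspace V}) (E' : 'I_d'.+1 -> {vspace V}) :
  eigenspace_ordering F E -> eigenspace_ordering F E' -> (d <= d')%N.
Proof.
move=> [injE eigE _] [_ _ surjE'].
have /fin_all_exists[g gE] : forall p, exists p', E p = E' p'.
  by move=> p; have [t /surjE'[p' E'p'] ->] := eigE p; exists p'.
rewrite -ltnS -[X in (_ <= X)%N]card_ord -[X in (X <= _)%N]card_ord.
by apply: (leq_card g) => p p' gpp'; apply: injE; rewrite !gE gpp'.
Qed.

(** Positive dimension makes each [th p] an eigenvalue, and a nonzero vector common to two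
    eigenspaces would identify their eigenvalues. *)
Lemma eigenspace_ordering_theta (K : fieldType) (V : vectType K) (F : 'End(V))
    (N : nat) (th : nat -> K) (rho : nat -> nat) :
  (forall p r, (p <= N)%N -> (r <= N)%N -> th p = th r -> p = r) ->
  (forall p, (p <= N)%N -> \dim (leigenspace F (th p)) = rho p) ->
  (forall p, (p <= N)%N -> (0 < rho p)%N) ->
  (forall t, leigenvalue F t -> exists2 p, (p <= N)%N & t = th p) ->
  eigenspace_ordering F (fun p : 'I_N.+1 => leigenspace F (th p)).
Proof.
move=> th_inj dimE rho_gt0 eig_th.
have Ep0 (p : 'I_N.+1) : leigenspace F (th p) != 0%VS.
  by rewrite -dimv_eq0 dimE ?leq_ord // -lt0n rho_gt0 // leq_ord.
split.
- move=> p r Epr; apply: val_inj; apply: th_inj; rewrite ?leq_ord //.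
  have := Ep0 p; rewrite -vpick0; set v := vpick _ => v0.
  have /eqP Fp : F v == th p *: v by rewrite -memv_leigenspace memv_pick.
  have : F v == th r *: v by rewrite -memv_leigenspace -Epr memv_pick.
  rewrite Fp -subr_eq0 -scalerBl scaler_eq0 (negPf v0) orbF subr_eq0.
  by move/eqP.
- by move=> p; exists (th p) => //; exact: Ep0.
- move=> t /eig_th[p]; rewrite -ltnS => ltp ->.
  by exists (Ordinal ltp).
Qed.

(** The orderings inside a TD pair enumerate the same eigenspaces as the given ones, which fixes
    both diameters. *)
Lemma TD_diameter_shape_of_eigenspaces (K : fieldType) (V : vectType K)
    (A As : 'End(V)) (N : nat) (th ths : nat -> K) (rho : nat -> nat) :
  eigenspace_ordering A (fun p : 'I_N.+1 => leigenspace A (th p)) ->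
  eigenspace_ordering As (fun p : 'I_N.+1 => leigenspace As (ths p)) ->
  (forall p, (p <= N)%N -> \dim (leigenspace A (th p)) = rho p) ->
  (forall p, (p <= N)%N -> \dim (leigenspace As (ths p)) = rho p) ->
  TD_diameter_shape A As N th ths rho.
Proof.
move=> oA oAs dA dAs; split=> // [d delta|p lepN]; last by split; auto.
case=> _ _ [E [oE _]] [Es [oEs _]] _; split; apply/eqP; rewrite eqn_leq.
  by rewrite (eigenspace_ordering_leq _ _ _ _ _ _ _ oE oA)
             (eigenspace_ordering_leq _ _ _ _ _ _ _ oA oE).
by rewrite (eigenspace_ordering_leq _ _ _ _ _ _ _ oEs oAs)
           (eigenspace_ordering_leq _ _ _ _ _ _ _ oAs oEs).
Qed.

(** For given [i] the only candidate is k = p - i, and it is admissible exactly when p - n2 <= i <=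
    p (truncated subtraction). It remains to count such [i] up to [n1]. *)
Lemma card_antidiagonal (n1 n2 p : nat) : (p <= n1 + n2)%N ->
  #|[pred ik : 'I_n1.+1 * 'I_n2.+1 | ik.1 + ik.2 == p]%N|
    = (minn n1 p + minn n2 p + 1 - p)%N.
Proof.
move=> lep; rewrite -sum1_card big_mkcond /=.
rewrite -(pair_big xpredT xpredT (fun (i : 'I_n1.+1) (k : 'I_n2.+1) =>
  if (i + k == p)%N then 1%N else 0%N)) /=.
have inner (i : nat) : (\sum_(k < n2.+1) (if i + k == p then 1 else 0)
    = (p - n2 <= i <= p))%N.
  have [h|h] := boolP (p - n2 <= i <= p)%N.
    have ltk : (p - i < n2.+1)%N by lia.
    rewrite (bigD1 (Ordinal ltk)) //= subnKC ?eqxx; last by lia.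
    rewrite big1 // => k /eqP kn; case: eqP => // ikp.
    by case: kn; apply: val_inj => /=; lia.
  by rewrite big1 // => k _; case: eqP => // ikp; have := ltn_ord k; lia.
under eq_bigr => i _ do rewrite inner.
have sum_upto m :
    (\sum_(i < m) (p - n2 <= i <= p) = minn m p.+1 - minn m (p - n2))%N.
  by elim: m => [|m IH]; rewrite ?big_ord0 ?big_ord_recr /= ?IH; lia.
by rewrite sum_upto; lia.
Qed.

(** * One variable: bidiagonal action on q-shifted factorials and the eigenbasis *)

Definition poly_eval (K : fieldType) (m n : nat) (P : 'M[K]_(m, n)) (i : 'I_m)
    (x : K) : K := \sum_(j < n) P i j * x ^+ j.

(* Eigenvectors of a map that is lower bidiagonal,
   [w_r |-> th_r w_r - k_r w_(r+1)], with distinct diagonal entries. *)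
Definition bidiag_coef (K : fieldType) (th k : nat -> K) (p r : nat) : K :=
  if (r < p)%N then 0 else \prod_(p <= l < r) (k l / (th l.+1 - th p)).

(** Comparing coefficients of [w r] gives the recursion [c_rec], which [bidiag_coef] solves. The
    [w r] and [g r] are scalars, meant as values at a fixed point of the basis polynomials and of
    their images. *)
Lemma bidiag_eigen (K : fieldType) (n p : nat) (th k w g : nat -> K) :
  (forall r, (p < r <= n)%N -> th r != th p) -> k n = 0 ->
  (forall r, (r <= n)%N -> g r = th r * w r - k r * w r.+1) ->
  \sum_(r < n.+1) bidiag_coef K th k p r * g r
    = th p * \sum_(r < n.+1) bidiag_coef K th k p r * w r.
Proof.
move=> th_neq kn gE; set c := bidiag_coef K th k p.
(* At r + 1 = p both sides vanish: the left by its second factor, the right because [c r] lies below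
   the diagonal. *)
have c_rec r : (r < n)%N -> c r.+1 * (th r.+1 - th p) = c r * k r.
  move=> ltrn; rewrite /c /bidiag_coef; case: (ltngtP r.+1 p) => [lt|gt|<-].
  - by rewrite !mul0r.
  - rewrite big_nat_recr //=; field.
    by rewrite subr_eq0 th_neq // gt ltrn.
  - by rewrite mul0r subrr mulr0.
have c_0 : c 0%N * (th 0%N - th p) = 0.
  by rewrite /c /bidiag_coef; case: p {th_neq c c_rec} => [|p] /=;
    rewrite ?subrr ?mulr0 ?mul0r.
apply/eqP; rewrite -subr_eq0 mulr_sumr -sumrB.
have -> : \sum_(r < n.+1) (c r * g r - th p * (c r * w r)) =
    \sum_(r < n.+1) c r * (th r - th p) * w r - \sum_(r < n.+1) c r * k r * w r.+1.
  by rewrite -sumrB; apply: eq_bigr => r _; rewrite gE ?leq_ord //; ring.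
(* The first sum loses its term r = 0 by [c_0], the second its term r = n by [kn]; the rest cancels
   termwise by [c_rec]. *)
rewrite big_ord_recl big_ord_recr /= c_0 kn mulr0 !mul0r add0r addr0 -sumrB.
rewrite big1 // => r _; rewrite /bump /= add1n c_rec ?subrr //.
Qed.

(** The q-shifted factorial (v x; t)_r, as a polynomial in x. *)
Definition qfact_poly (K : fieldType) (t v : K) (r : nat) : {poly K} :=
  \prod_(l < r) (1 - (v * t ^+ l) *: 'X).

Lemma qfact_polyS (K : fieldType) (t v : K) (r i : nat) :
  (qfact_poly K t v r.+1)`_i = (qfact_poly K t v r)`_i
    - v * t ^+ r * (if i is j.+1 then (qfact_poly K t v r)`_j else 0).
Proof.
rewrite /qfact_poly big_ord_recr /= mulrBr mulr1 coefB -scalerAr coefZ coefMX.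
by case: i.
Qed.

(** This makes the coefficient matrix of the factorials lower triangular, with a nonzero diagonal
    when [t] and [v] are nonzero. *)
Lemma qfact_poly_lead (K : fieldType) (t v : K) (r : nat) :
  (forall i, (r < i)%N -> (qfact_poly K t v r)`_i = 0) /\
  (qfact_poly K t v r)`_r = \prod_(l < r) (- (v * t ^+ l)).
Proof.
elim: r => [|r [IH0 IH]].
  rewrite /qfact_poly !big_ord0; split=> [[//|i] _|]; by rewrite coef1.
split=> [[|i]|] //.
  by move=> ltri; rewrite qfact_polyS !IH0 ?mulr0 ?subr0 // ltnW.
by rewrite qfact_polyS IH0 // IH big_ord_recr /= mulrC sub0r mulrN.
Qed.

(** The substitution x -> t x turns each factor into the next one, and 1 - v x supplies the missing
    first factor. *)
Lemma qfact_poly_shift (K : fieldType) (t v x : K) (r : nat) :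
  (1 - v * x) * (qfact_poly K t v r).[t * x] = (qfact_poly K t v r.+1).[x].
Proof.
rewrite /qfact_poly !horner_prod big_ord_recl /= !hornerE.
congr (_ * _); apply: eq_bigr => l _.
by rewrite !hornerE /bump /= add1n exprSr; ring.
Qed.

Section OneVariable.
Variables (K : fieldType) (s a u : K) (n : nat).
Hypotheses (s0 : s != 0) (a0 : a != 0) (u0 : u != 0).

(** The argument [s ^+ 2 * (s ^+ 2 * x)] is what two successive q-shifts unfold to when q = s^2. The
    parameter [a'] is free so that shifted values of [a] can be inserted. *)
Definition opA_poly_eigen (a' th : K) (f : K -> K) : Prop :=
  forall x, x != 0 ->
    (u * x * s ^+ n + u^-1 * x^-1 * s ^- n) * f x
    - u^-1 * s ^- n * x^-1
      * (1 - x * u * s ^- n * a') * (1 - x * u * s ^- n * a'^-1)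
      * f (s ^+ 2 * (s ^+ 2 * x))
    = th * f x.

(** The factor of the operator containing [a] is absorbed by [qfact_poly_shift] into [w r.+1], a
    linear factor times [w r]. Then (w r).[x] factors out of both sides, leaving a rational identity
    in which the poles at x = 0 cancel. *)
Lemma opA_qfact_poly (x : K) (r : nat) : x != 0 ->
  let w := qfact_poly K (s ^+ 4) (u * s ^- n * a) in
  (u * x * s ^+ n + u^-1 * x^-1 * s ^- n) * (w r).[x]
    - u^-1 * s ^- n * x^-1
      * (1 - x * u * s ^- n * a) * (1 - x * u * s ^- n * a^-1)
      * (w r).[s ^+ 2 * (s ^+ 2 * x)]
  = theta (s ^+ 2) n a r * (w r).[x]
    - (s ^+ (2 * n) / s ^+ (4 * r) - s ^- (2 * n)) / a * (w r.+1).[x].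
Proof.
move=> x0 w; have sn0 : s ^+ n != 0 by rewrite expf_neq0.
have sr0 : s ^+ (4 * r) != 0 by rewrite expf_neq0.
rewrite (_ : s ^+ 2 * (s ^+ 2 * x) = s ^+ 4 * x); last by ring.
have -> : theta (s ^+ 2) n a r =
    s ^+ (4 * r) / s ^+ (2 * n) * a + s ^+ (2 * n) / s ^+ (4 * r) * a^-1.
  have s20 : s ^+ 2 != 0 by rewrite expf_neq0.
  rewrite /theta -[2 * r%:Z]/((2 * r)%N%:Z) !expfzDr // -!exprnN -!exprnP -!exprM.
  by rewrite mulnA.
have wS := qfact_poly_shift K (s ^+ 4) (u * s ^- n * a) x r.
have wSr : (w r.+1).[x] = (w r).[x] * (1 - u * s ^- n * a * s ^+ (4 * r) * x).
  by rewrite /w /qfact_poly big_ord_recr /= hornerM !hornerE -exprM.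
rewrite -/w wSr in wS *.
have -> : 1 - x * u * s ^- n * a = 1 - u * s ^- n * a * x by ring.
transitivity ((u * x * s ^+ n + u^-1 * x^-1 * s ^- n) * (w r).[x]
  - u^-1 * s ^- n * x^-1 * (1 - x * u * s ^- n * a^-1)
      * ((1 - u * s ^- n * a * x) * (w r).[s ^+ 4 * x])); first by ring.
rewrite wS mul2n -addnn exprD; field.
by rewrite sr0 sn0 x0 a0 u0.
Qed.

(** A basis is encoded as an invertible matrix whose rows are coefficient vectors. Here it is
    [C *m W]: [C] writes the eigenvectors in the factorials, [W] the factorials in the monomials,
    and both are triangular. *)
Lemma opA_eigenbasis :
  (forall p r, (p <= n)%N -> (r <= n)%N ->
     theta (s ^+ 2) n a p = theta (s ^+ 2) n a r -> p = r) ->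
  exists2 P : 'M[K]_n.+1, P \in unitmx
    & forall i : 'I_n.+1, opA_poly_eigen a (theta (s ^+ 2) n a i) (poly_eval K _ _ P i).
Proof.
move=> th_inj; set th := theta (s ^+ 2) n a in th_inj *.
pose w := qfact_poly K (s ^+ 4) (u * s ^- n * a).
pose k r := (s ^+ (2 * n) / s ^+ (4 * r) - s ^- (2 * n)) / a.
pose C := \matrix_(p < n.+1, r < n.+1) bidiag_coef K th k p r.
pose W := \matrix_(r < n.+1, i < n.+1) (w r)`_i.
have PE i x : poly_eval K _ _ (C *m W) i x =
    \sum_(r < n.+1) bidiag_coef K th k i r * (w r).[x].
  rewrite /poly_eval.
  under eq_bigr => j _ do rewrite mxE mulr_suml.
  rewrite exchange_big; apply: eq_bigr => r _ /=.
  have sz : (size (w r) <= n.+1)%N.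
    apply/leq_sizeP => j ltnj.
    have [w_high _] := qfact_poly_lead K (s ^+ 4) (u * s ^- n * a) r.
    exact: w_high (leq_trans (ltn_ord r) ltnj).
  rewrite (horner_coef_wide _ sz) mulr_sumr; apply: eq_bigr => j _.
  by rewrite !mxE mulrA.
exists (C *m W).
  rewrite unitmx_mul !unitmxE !unitfE; apply/andP; split.
    (* [C] is upper triangular; its diagonal entries are empty products, hence 1. *)
    rewrite -det_tr det_trig; last first.
      by apply/is_trig_mxP => i j ltij; rewrite !mxE /bidiag_coef ltij.
    rewrite big1 ?oner_eq0 // => i _.
    by rewrite !mxE /bidiag_coef ltnn big_geq.
  rewrite det_trig; last first.
    apply/is_trig_mxP => i j ltij; rewrite mxE.
    have [w_high _] := qfact_poly_lead K (s ^+ 4) (u * s ^- n * a) i.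
    exact: w_high.
  apply/prodf_neq0 => i _; rewrite mxE.
  have [_ ->] := qfact_poly_lead K (s ^+ 4) (u * s ^- n * a) i.
  by apply/prodf_neq0 => l _; rewrite oppr_eq0 !mulf_neq0 ?invr_eq0 ?expf_neq0.
move=> i x x0; rewrite !PE.
pose g r := (u * x * s ^+ n + u^-1 * x^-1 * s ^- n) * (w r).[x]
    - u^-1 * s ^- n * x^-1
      * (1 - x * u * s ^- n * a) * (1 - x * u * s ^- n * a^-1)
      * (w r).[s ^+ 2 * (s ^+ 2 * x)].
have /= <- := bidiag_eigen K n i th k (fun r => (w r).[x]) g; last 3 first.
- move=> r /andP[ltir lern]; apply/eqP => /th_inj ri.
  by rewrite ri ?ltnn ?leq_ord // in ltir.
(* At r = n the two powers of [s] in [k] coincide, so no factorial of degree n + 1 is produced. *)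
- rewrite /k (_ : (4 * n = 2 * n + 2 * n)%N); last by lia.
  by rewrite exprD; field; rewrite a0 expf_neq0.
- by move=> r _; exact: opA_qfact_poly.
rewrite !mulr_sumr -sumrB; apply: eq_bigr => r _.
rewrite /g; ring.
Qed.

End OneVariable.

(** * Two variables: values of bipolynomials and product bases *)

Lemma bievalZ (K : fieldType) (n1 n2 : nat) (c : K) (f : bipoly K n1 n2)
    (x y : K) :
  bieval (c *: f) x y = c * bieval f x y.
Proof.
rewrite /bieval mulr_sumr; apply: eq_bigr => i _; rewrite mulr_sumr.
by apply: eq_bigr => k _; rewrite mxE !mulrA.
Qed.

(** Reduced to [induces_unique]: the linear maps sending v to v(0,0) f and to v(0,0) g are both
    induced by the operator that multiplies [bieval g] by v(0,0), so they agree. Taking v with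
    constant coefficient 1 gives f = g. *)
Lemma bieval_inj (K : numFieldType) (n1 n2 : nat) (f g : bipoly K n1 n2) :
  (forall x y, x != 0 -> y != 0 -> bieval f x y = bieval g x y) -> f = g.
Proof.
move=> fg.
pose L (h v : bipoly K n1 n2) : bipoly K n1 n2 := v ord0 ord0 *: h.
have L_linear h : linear (L h).
  by move=> c v w; rewrite /L !mxE scalerDl scalerA.
pose Lin h : {linear bipoly K n1 n2 -> bipoly K n1 n2} :=
  HB.pack (L h) (GRing.isLinear.Build _ _ _ _ _ (L_linear h)).
have bieval00 (v : bipoly K n1 n2) : bieval v 0 0 = v ord0 ord0.
  rewrite /bieval !big_ord_recl /= !expr0 !mulr1 !big1 ?addr0 // => i _.
    by apply: big1 => k _; rewrite expr0n mulr0 mul0r.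
  by rewrite expr0n mulr0.
have LP (h h' : bipoly K n1 n2) :
    (forall x y, x != 0 -> y != 0 -> bieval h x y = bieval h' x y) ->
    induces (fun v x y => v 0 0 * bieval h' x y) (linfun (Lin h)).
  by move=> hh' v x y x0 y0; rewrite lfunE /= bievalZ hh' // bieval00.
have := induces_unique (LP f g fg) (LP g g (fun _ _ _ _ => erefl)).
move/lfunP/(_ (const_mx 1)); rewrite !lfunE /= /L mxE !scale1r.
by [].
Qed.

(** The first basis may vary with [k]. Column [k] of [X] collects everything paired with row [k] of
    [Psi]; invertibility of [Psi] kills [X], then that of each [Phi k] kills the coefficients. *)
Lemma tensor_free (K : fieldType) (n1 n2 : nat) (Phi : 'I_n2.+1 -> 'M[K]_n1.+1)
    (Psi : 'M[K]_n2.+1) (c : 'I_n1.+1 -> 'I_n2.+1 -> K) :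
  (forall k, Phi k \in unitmx) -> Psi \in unitmx ->
  \sum_i \sum_k c i k *: ((row i (Phi k))^T *m row k Psi) = 0 ->
  forall i k, c i k = 0.
Proof.
move=> Phi_unit Psi_unit c0 i k.
pose X := \matrix_(j < n1.+1, k < n2.+1) \sum_i c i k * Phi k i j.
have XPsi : X *m Psi = 0.
  rewrite -[RHS]c0; apply/matrixP => j l; rewrite mxE summxE.
  under eq_bigr => k' _ do rewrite mxE mulr_suml.
  rewrite exchange_big; apply: eq_bigr => i' _; rewrite summxE.
  by apply: eq_bigr => k' _; rewrite !mxE big_ord1 !mxE mulrA.
have X0 : X = 0 by rewrite -(mulmxK Psi_unit X) XPsi mul0mx.
have cPhi : (\row_i c i k) *m Phi k = 0.
  apply/matrixP => z j; have /matrixP/(_ j k) := X0; rewrite !mxE => {2}<-.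
  by apply: eq_bigr => i' _; rewrite mxE.
have c_row : \row_i c i k = 0.
  by rewrite -(mulmxK (Phi_unit k) (\row_i c i k)) cPhi mul0mx.
by have /matrixP/(_ ord0 i) := c_row; rewrite !mxE.
Qed.

Lemma bieval_tensor (K : fieldType) (m1 m2 n1 n2 : nat) (P : 'M[K]_(m1, n1.+1))
    (Q : 'M[K]_(m2, n2.+1)) (i : 'I_m1) (k : 'I_m2) (x y : K) :
  bieval ((row i P)^T *m row k Q) x y = poly_eval K _ _ P i x * poly_eval K _ _ Q k y.
Proof.
rewrite /bieval /poly_eval mulr_suml; apply: eq_bigr => j _.
rewrite mulr_sumr; apply: eq_bigr => l _; rewrite !mxE big_ord1 !mxE.
ring.
Qed.

(** * The eigenvalues theta: distinctness, multiplicities and parameter shifts *)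

(** The difference of two values is (q^(2p-N) - q^(2r-N)) (a - q^(2e) / a) with e = N - p - r. The
    first factor vanishes only for p = r, as q is not a root of unity; the second only if a is q^e
    or -q^e. *)
Lemma theta_inj (K : fieldType) (q : K) (N : nat) (a : K) :
  q != 0 -> (forall m : nat, (0 < m)%N -> q ^+ m != 1) -> a != 0 ->
  (forall x, x \in [:: a; - a] -> forall m : int, `|m| <= N%:Z - 1 -> x != q ^ m) ->
  forall p r, (p <= N)%N -> (r <= N)%N -> theta q N a p = theta q N a r -> p = r.
Proof.
move=> q0 q_not_root a0 a_neq.
have q_inj (m m' : int) : q ^ m = q ^ m' -> m = m'.
  wlog le_mm' : m m' / m <= m'.
    by move=> H; case: (leP m m') => [/H//|/ltW/H H' /esym/H'].
  move=> E; apply/eqP; rewrite eq_le le_mm' /= leNgt; apply/negP => lt_mm'.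
  have := q_not_root `|m' - m|%N; rewrite absz_gt0 subr_eq0 gt_eqF // => /(_ isT).
  rewrite exprnP gtz0_abs ?subr_gt0 // expfzDr // -E -expfzDr // subrr expr0z.
  by rewrite eqxx.
move=> p r lep ler Epr; apply/eqP; apply/negPn/negP => npr.
pose e : int := N%:Z - p%:Z - r%:Z.
have : (q ^ (2 * p%:Z - N%:Z) - q ^ (2 * r%:Z - N%:Z)) * (a - q ^ (e + e) * a^-1) = 0.
  rewrite -(subrr (theta q N a r)) -{1}Epr /theta.
  rewrite mulrBr !mulrBl !mulrA -!expfzDr //.
  rewrite (_ : _ + (e + e) = N%:Z - 2 * r%:Z); last by rewrite /e; ring.
  rewrite (_ : _ + (e + e) = N%:Z - 2 * p%:Z); last by rewrite /e; ring.
  ring.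
move/eqP; rewrite mulf_eq0 subr_eq0 => /orP[/eqP/q_inj E|]; first by lia.
rewrite subr_eq0 => /eqP aE.
have /eqP : a ^+ 2 = (q ^ e) ^+ 2.
  by rewrite !expr2 -expfzDr // {1}aE mulfVK.
(* |e| = N would force p = r = 0 or p = r = N. *)
have e_le : `|e| <= N%:Z - 1 by rewrite /e; lia.
rewrite eqf_sqr => /orP[/eqP aq|/eqP aq].
  by have := a_neq a; rewrite mem_head aq => /(_ isT e e_le); rewrite eqxx.
have := a_neq (- a); rewrite !inE eqxx orbT => /(_ isT e e_le).
by rewrite aq opprK eqxx.
Qed.

(** The share of [TD_diameter_shape] that concerns a single operator. *)
Definition spectrum_theta (K : fieldType) (n1 n2 : nat) (q a : K)
    (F : 'End(bipoly K n1 n2)) : Prop :=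
  let N := (n1 + n2)%N in
  eigenspace_ordering F (fun p : 'I_N.+1 => leigenspace F (theta q N a p)) /\
  forall p, (p <= N)%N -> \dim (leigenspace F (theta q N a p))
    = (minn n1 p + minn n2 p + 1 - p)%N.

Definition theta_injective (K : fieldType) (q : K) (N : nat) (a : K) : Prop :=
  forall p r, (p <= N)%N -> (r <= N)%N -> theta q N a p = theta q N a r -> p = r.

Lemma spectrum_of_eigenbasis (K : fieldType) (n1 n2 : nat) (q a : K)
    (F : 'End(bipoly K n1 n2)) (e : 'I_n1.+1 -> 'I_n2.+1 -> bipoly K n1 n2) :
  theta_injective K q (n1 + n2) a ->
  (forall c : 'I_n1.+1 -> 'I_n2.+1 -> K,
     \sum_i \sum_k c i k *: e i k = 0 -> forall i k, c i k = 0) ->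
  (forall i k, F (e i k) = theta q (n1 + n2) a (i + k) *: e i k) ->
  spectrum_theta K n1 n2 q a F.
Proof.
move=> th_inj e_free Fe; set N := (n1 + n2)%N.
pose lam (ik : 'I_n1.+1 * 'I_n2.+1) := theta q N a (ik.1 + ik.2).
have le_ik (ik : 'I_n1.+1 * 'I_n2.+1) : (ik.1 + ik.2 <= N)%N.
  by rewrite leq_add ?leq_ord.
have dimE t : \dim (leigenspace F t) = #|[pred ik | lam ik == t]|.
  apply: (dim_leigenspace_eigenbasis _ _ _ _ (fun ik => e ik.1 ik.2)).
  - move=> c c0 [i k]; apply: (e_free (fun i k => c (i, k))).
    rewrite -[RHS]c0 pair_big /=.
    by apply: eq_bigr => -[].
  - by rewrite card_prod !card_ord dimvf /dim /=.
  - by move=> [i k]; exact: Fe.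
(* Since theta is injective, the pairs with eigenvalue theta p are those with i + k = p. *)
have dim_th p : (p <= N)%N ->
    \dim (leigenspace F (theta q N a p)) = (minn n1 p + minn n2 p + 1 - p)%N.
  move=> lep; rewrite dimE -card_antidiagonal //; apply: eq_card => ik.
  rewrite !inE /lam; apply/eqP/eqP => [|-> //].
  by apply: th_inj.
split=> //; apply: (eigenspace_ordering_theta _ _ _ _ _ _ th_inj dim_th).
  by move=> p lep; lia.
move=> t; rewrite /leigenvalue -dimv_eq0 dimE -lt0n => /card_gt0P[ik].
by rewrite inE => /eqP <-; exists (ik.1 + ik.2)%N.
Qed.

Lemma theta_shift (K : fieldType) (q a : K) (n1 n2 i k : nat) : q != 0 ->
  theta q n1 (q ^ (2 * k%:Z - n2%:Z) * a) i = theta q (n1 + n2) a (i + k).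
Proof.
move=> q0; rewrite /theta invfM invr_expz !mulrA -!expfzDr //.
by congr (q ^ _ * _ + q ^ _ * _); lia.
Qed.

(** In this form an eigenvalue of one factor can serve as a' + 1/a' for the other. *)
Lemma theta_sum_inv (K : fieldType) (q a : K) (n k : nat) : q != 0 ->
  theta q n a k = (q ^ (2 * k%:Z - n%:Z) * a) + (q ^ (2 * k%:Z - n%:Z) * a)^-1.
Proof.
move=> q0; rewrite /theta invfM invr_expz; congr (_ + q ^ _ * _); lia.
Qed.

(* Only the coefficient of [f (q ^ 2 * x)] in opA depends on [a'], through
   [a' + 1 / a']: adding [th * q ^ (- n) * T ^ 2] amounts to changing [a']. *)
Lemma opA_change_parameter (K : fieldType) (s a a' u x y fx fy fx' fy' c2 d2 : K)
    (n1 : nat) :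
  s != 0 -> a != 0 -> a' != 0 -> u != 0 -> x != 0 ->
  c2 * fy - d2 * fy' = (a' + a'^-1) * fy ->
  (u * x * s ^+ n1 + u^-1 * x^-1 * s ^- n1) * (fx * fy)
  - u^-1 * s ^- n1 * x^-1 * (1 - x * u * s ^- n1 * a)
    * (1 - x * u * s ^- n1 * a^-1) * (fx' * fy)
  + (s ^+ 2) ^- n1 * (c2 * (fx' * fy) - d2 * (fx' * fy')
      - (a + a^-1) * (fx' * fy))
  = ((u * x * s ^+ n1 + u^-1 * x^-1 * s ^- n1) * fx
  - u^-1 * s ^- n1 * x^-1 * (1 - x * u * s ^- n1 * a')
    * (1 - x * u * s ^- n1 * a'^-1) * fx') * fy.
Proof.
move=> s0 a0 a'0 u0 x0 fyE.
have sn0 : s ^+ n1 != 0 by rewrite expf_neq0.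
(* [c2 * fy - d2 * fy'] stands for the value of the second operator on the second factor, an
   eigenvector; [fx'] and [fy'] are values at shifted points. *)
have -> : c2 * (fx' * fy) - d2 * (fx' * fy') - (a + a^-1) * (fx' * fy)
    = fx' * (c2 * fy - d2 * fy' - (a + a^-1) * fy) by ring.
rewrite fyE exprAC; field.
by rewrite sn0 a0 a'0 u0 x0.
Qed.

(** * Spectra of A_12 and A_21 *)

Section Spectra.
Variables (K : numFieldType) (q s : K) (n1 n2 : nat) (a u1 u2 : K).
Hypotheses (hs : s ^+ 2 = q) (q0 : q != 0) (a0 : a != 0).
Hypotheses (u10 : u1 != 0) (u20 : u2 != 0).

Let s0 : s != 0. Proof. by move: q0; rewrite -hs expf_eq0. Qed.

(** By [theta_shift], the diagonal entries for the shifted parameter are theta at i + k for the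
    total degree m + m', so their distinctness is inherited from there. *)
Let shifted_eigenbasis (m m' : nat) (u : K) (k : 'I_m'.+1) :
  theta_injective K q (m + m') a -> u != 0 ->
  exists2 P : 'M[K]_m.+1, P \in unitmx
    & forall i : 'I_m.+1, opA_poly_eigen K s u m (q ^ (2 * k%:Z - m'%:Z) * a)
        (theta q (m + m') a (i + k)) (poly_eval K _ _ P i).
Proof.
move=> th_inj u0.
have [||||P Pu Pe] := opA_eigenbasis K s (q ^ (2 * k%:Z - m'%:Z) * a) u m => //.
- by rewrite mulf_neq0 ?expfz_neq0.
- move=> p r lep ler; rewrite hs !theta_shift // => /th_inj E.
  by apply: (@addIn k); apply: E; rewrite leq_add ?leq_ord.
- by exists P => // i; have := Pe i; rewrite hs theta_shift.
Qed.

Lemma opA12_spectrum (F : 'End(bipoly K n1 n2)) :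
  theta_injective K q (n1 + n2) a -> theta_injective K q n2 a ->
  induces (opA12 q s n1 n2 a u1 u2) F -> spectrum_theta K n1 n2 q a F.
Proof.
move=> th_inj th_inj2 FP.
have [|Psi Psi_unit Psi_eig] := opA_eigenbasis K s a u2 n2 s0 a0 u20.
  by rewrite hs.
have /fin_all_exists2[Phi Phi_unit Phi_eig] :=
  fun k : 'I_n2.+1 => shifted_eigenbasis n1 n2 u1 k th_inj u10.
apply: (spectrum_of_eigenbasis _ _ _ _ _ _
  (fun i k => (row i (Phi k))^T *m row k Psi)) => //.
  by move=> c; apply: tensor_free.
move=> i k; apply: bieval_inj => x y x0 y0; rewrite FP //.
rewrite bievalZ /opA12 /opA1 /opA2 /opA_gen /T1p /T2p /shift1 /shift2.
(* The eigenvalue on the right is traded back for the one-variable operator with parameter a', the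
   form that [opA_change_parameter] produces. *)
rewrite /coord1 /coord2 !bieval_tensor [RHS]mulrA -(Phi_eig k i x x0) -hs.
apply: opA_change_parameter => //.
  by rewrite mulf_neq0 ?expfz_neq0 ?hs.
by rewrite (Psi_eig k y y0) hs theta_sum_inv.
Qed.

(** Now the basis in z2 depends on the eigenvector of A_1 in z1. The shift in z2 is applied before
    A_1, but on a product the two act on different variables, so the values agree with those of the
    other order. *)
Lemma opA21_spectrum (F : 'End(bipoly K n1 n2)) :
  theta_injective K q (n1 + n2) a -> theta_injective K q n1 a ->
  induces (opA21 q s n1 n2 a u1 u2) F -> spectrum_theta K n1 n2 q a F.
Proof.
move=> th_inj th_inj1 FP.
have [|Phi Phi_unit Phi_eig] := opA_eigenbasis K s a u1 n1 s0 a0 u10.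
  by rewrite hs.
have th_inj' : theta_injective K q (n2 + n1) a by rewrite addnC.
have /fin_all_exists2[Psi Psi_unit Psi_eig] :=
  fun i : 'I_n1.+1 => shifted_eigenbasis n2 n1 u2 i th_inj' u20.
apply: (spectrum_of_eigenbasis _ _ _ _ _ _
  (fun i k => (row i Phi)^T *m row k (Psi i))) => //.
  move=> c c0 i k.
  (* Transposition exchanges the two variables, so that the varying basis comes first. *)
  apply: (tensor_free K n2 n1 Psi Phi (fun k i => c i k)) => //.
  rewrite exchange_big -[RHS]trmx0 -c0 linear_sum; apply: eq_bigr => i' _.
  rewrite linear_sum; apply: eq_bigr => k' _.
  by rewrite linearZ /= trmx_mul trmxK.
move=> i k; apply: bieval_inj => x y x0 y0; rewrite FP //.
rewrite bievalZ /opA21 /opA1 /opA2 /opA_gen /T1p /T2p /shift1 /shift2.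
rewrite /coord1 /coord2 !bieval_tensor (addnC n1) (addnC i).
rewrite [RHS]mulrCA [RHS]mulrC -(Psi_eig i k y y0) -hs.
have a'0 : (s ^+ 2) ^ (2 * i%:Z - n1%:Z) * a != 0.
  by rewrite mulf_neq0 ?expfz_neq0 ?hs.
rewrite -(opA_change_parameter K s a _ u2 y x _ _ _ _ _ _ n2 s0 a0 a'0 u20 y0
  (etrans (Phi_eig i x x0) _)); last by rewrite hs theta_sum_inv.
ring.
Qed.

End Spectra.

(** * The operators B, by inversion of the parameters *)

(** Inverting [b] merely exchanges the two linear factors. It is done so that [theta_inv] preserves
    the index; with [b] kept, p would become N - p. *)
Lemma opB_genE (K : fieldType) (T : (K -> K -> K) -> K -> K -> K)
    (z : K -> K -> K) (s : K) (n : nat) (b u : K) (f : K -> K -> K) (x y : K) :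
  opB_gen T z s n b u f x y = opA_gen T z s^-1 n b^-1 u^-1 f x y.
Proof.
rewrite /opB_gen /opA_gen exprVn !invrK; congr (_ - _ * _).
by rewrite mulrAC.
Qed.

Lemma opB21E (K : fieldType) (q s : K) (n1 n2 : nat) (b u1 u2 : K)
    (f : K -> K -> K) (x y : K) :
  opB21 q s n1 n2 b u1 u2 f x y
    = opA12 q^-1 s^-1 n1 n2 b^-1 u1^-1 u2^-1 f x y.
Proof.
rewrite /opB21 /opA12 /opB1 /opB2 /opA1 /opA2 opB_genE /T1m /shift1 opB_genE.
by rewrite exprVn !invrK (addrC b).
Qed.

Lemma opB12E (K : fieldType) (q s : K) (n1 n2 : nat) (b u1 u2 : K)
    (f : K -> K -> K) (x y : K) :
  opB12 q s n1 n2 b u1 u2 f x y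
    = opA21 q^-1 s^-1 n1 n2 b^-1 u1^-1 u2^-1 f x y.
Proof.
rewrite /opB12 /opA21 /opB1 /opB2 /opA1 /opA2 !opB_genE.
by rewrite exprVn !invrK (addrC b).
Qed.

Lemma theta_inv (K : fieldType) (q b : K) (N p : nat) :
  theta q^-1 N b^-1 p = theta q N b p.
Proof.
rewrite /theta !exprz_inv !opprB invrK addrC.
by congr (q ^ _ * _ + q ^ _ * _); lia.
Qed.

Lemma spectrum_theta_inv (K : fieldType) (n1 n2 : nat) (q b : K)
    (F : 'End(bipoly K n1 n2)) :
  spectrum_theta K n1 n2 q^-1 b^-1 F -> spectrum_theta K n1 n2 q b F.
Proof.
case=> oF dF; split=> [|p lep]; last by have := dF p lep; rewrite theta_inv.
case: oF => E_inj E_eig E_surj; split.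
- by move=> p r E_eq; apply: E_inj; rewrite !theta_inv.
- by move=> p; have := E_eig p; rewrite theta_inv.
- by move=> t /E_surj[p Ep]; exists p; rewrite -Ep theta_inv.
Qed.

Theorem proposition4p5 (R : realType) (q s : R[i]) (n1 n2 : nat)
    (a b u1 u2 : R[i])
    (q_neq0 : q != 0)
    (q_not_root : forall m : nat, (0 < m)%N -> q ^+ m != 1)
    (s_sqrt : s ^+ 2 = q)
    (a_neq0 : a != 0) (b_neq0 : b != 0) (u1_neq0 : u1 != 0) (u2_neq0 : u2 != 0)
    (cond_i : forall e1 e2 : int, e1 \in [:: 1; -1] -> e2 \in [:: 1; -1] ->
      general_position q (qstring q n1 ((q / u1 ^+ 2) ^ e1))
                         (qstring q n2 ((q / u2 ^+ 2) ^ e2)))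
    (cond_ii1 : forall x : R[i], x \in [:: a * b; a / b] ->
      x \notin qstring q n1 (q / u1 ^+ 2) ++ qstring q n1 (q / u1 ^+ 2)^-1)
    (cond_ii2 : forall x : R[i], x \in [:: a * b; a / b] ->
      x \notin qstring q n2 (q / u2 ^+ 2) ++ qstring q n2 (q / u2 ^+ 2)^-1)
    (cond_iii : forall x : R[i], x \in [:: a; - a; b; - b] ->
      forall m : int, `|m| <= n1%:Z + n2%:Z - 1 -> x != q ^ m) :
  let N := (n1 + n2)%N in
  let rho := fun p : nat => (minn n1 p + minn n2 p + 1 - p)%N in
  TD_diameter_shape (A12 q s n1 n2 a u1 u2) (B21 q s n1 n2 b u1 u2)
    N (theta q N a) (theta q N b) rho
  /\
  TD_diameter_shape (A21 q s n1 n2 a u1 u2) (B12 q s n1 n2 b u1 u2)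
    N (theta q N a) (theta q N b) rho.
Proof.
(* Injectivity is needed for the total degree and for each single factor; the range of exponents
   excluded by [cond_iii] covers all of them. *)
have a_inj n : (n <= n1 + n2)%N -> theta_injective _ q n a.
  move=> len; apply: theta_inj => // x xa m lem; apply: cond_iii; last by lia.
  by move: xa; rewrite !inE => /orP[|] ->; rewrite ?orbT.
have b_inj n : (n <= n1 + n2)%N -> theta_injective _ q^-1 n b^-1.
  move=> len p r lep ler; rewrite !theta_inv.
  move: lep ler; move: p r; apply: theta_inj => // x xb m lem.
  apply: cond_iii; last by lia.
  by move: xb; rewrite !inE => /orP[|] ->; rewrite ?orbT.
have V0 x : x != 0 -> x^-1 != 0 :> R[i] by rewrite invr_eq0.
have sV : s^-1 ^+ 2 = q^-1 by rewrite exprVn s_sqrt.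
have lel := leq_addr n2 n1; have ler := leq_addl n1 n2.
have [oA12 dA12] : spectrum_theta _ n1 n2 q a (A12 q s n1 n2 a u1 u2).
  apply: (opA12_spectrum _ q s n1 n2 a u1 u2 s_sqrt); auto.
  exact: A12P.
have [oA21 dA21] : spectrum_theta _ n1 n2 q a (A21 q s n1 n2 a u1 u2).
  apply: (opA21_spectrum _ q s n1 n2 a u1 u2 s_sqrt); auto.
  exact: A21P.
have [oB21 dB21] : spectrum_theta _ n1 n2 q b (B21 q s n1 n2 b u1 u2).
  apply: spectrum_theta_inv.
  apply: (opA12_spectrum _ _ s^-1 _ _ _ u1^-1 u2^-1 sV); auto.
  (* The endomorphism induced by B_21 is also induced by the A_12 operator with inverted
     parameters. *)
  by move=> f x y x0 y0; rewrite -opB21E (B21P s_sqrt).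
have [oB12 dB12] : spectrum_theta _ n1 n2 q b (B12 q s n1 n2 b u1 u2).
  apply: spectrum_theta_inv.
  apply: (opA21_spectrum _ _ s^-1 _ _ _ u1^-1 u2^-1 sV); auto.
  by move=> f x y x0 y0; rewrite -opB12E (B12P s_sqrt).
by split; apply: TD_diameter_shape_of_eigenspaces.
Qed.
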